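(* The map $f\mapsto f^\blacktriangle$, where $$f^\blacktriangle(x)=\sum_{j=0}^x\binom{x}{j}f(j),\qquad x\in\mathbb Z_+,$$ defines a unitary mapping from $\ell^2(\mathbb Z_+)$ onto $\mathcal H(K)$, and its inverse $g\mapsto g^\blacktriangledown$ is given by either of the formulas $$g^\blacktriangledown=\sum_{n=0}^\infty a_n\delta_n\quad\text{for } g=\sum_{n=0}^\infty a_ne_n\in\mathcal H(K),$$ or $$g^\blacktriangledown(n)=\sum_{\ell=0}^n\binom{n}{\ell}(-1)^{\ell-n}g(\ell),\qquad n\in\mathbb Z_+.$$
   Context: $\mathbb Z_+=\{0,1,2,\ldots\}$; $\ell^2(\mathbb Z_+)$ is the space of real square-summable sequences; $\delta_n(m)=\delta_{n,m}$. For $n,x\in\mathbb Z_+$, $e_n(x)=\binom{x}{n}$ if $x\ge n$ and $e_n(x)=0$ if $x<n$. $K(x,y)=\sum_{n=0}^\infty e_n(x)e_n(y)=\binom{x+y}{x}$, and $\mathcal H(K)$ is the reproducing kernel Hilbert space of real-valued functions on $\mathbb Z_+$ with reproducing kernel $K$; it consists of all $g=\sum_{n=0}^\infty a_ne_n$ (pointwise finite sum) with $\sum a_n^2<\infty$, and $\|g\|^2_{\mathcal H(K)}=\sum a_n^2$. Unitary means a surjective linear isometry. *)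

(* Defs.v *)
From mathcomp Require Export all_boot all_order all_algebra.
From mathcomp Require Export all_classical all_reals all_analysis.

Set Implicit Arguments.
Unset Strict Implicit.
Unset Printing Implicit Defensive.

Export Order.TTheory GRing.Theory Num.Theory.
Export numFieldNormedType.Exports.

Local Open Scope classical_set_scope.
Local Open Scope ring_scope.

(* A space of real functions on X is a set H of functions, with pointwise
   operations, together with a form ip whose values matter only on H. *)
Section FunctionSpaces.
Variables (R : realType) (X : Type).
Implicit Types (H : set (X -> R)) (ip : (X -> R) -> (X -> R) -> R).

Definition ipnorm ip (f : X -> R) : R := Num.sqrt (ip f f).

Record is_inner_product H ip : Prop := {
  ip_sym : forall f g, H f -> H g -> ip f g = ip g f;
  ip_linear : forall (a : R) f g h, H f -> H g -> H h ->
    ip (a *: f + g) h = a * ip f h + ip g h;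
  ip_ge0 : forall f, H f -> 0 <= ip f f;
  ip_eq0 : forall f, H f -> ip f f = 0 -> f = 0 }.

Definition ip_complete H ip : Prop :=
  forall u : nat -> (X -> R), (forall n, H (u n)) ->
    (forall eps : R, 0 < eps -> exists N : nat, forall m n : nat,
      (N <= m)%N -> (N <= n)%N -> ipnorm ip (u m - u n) < eps) ->
    exists2 g, H g & (fun n => ipnorm ip (u n - g)) @ \oo --> (0 : R).

Record is_hilbert H ip : Prop := {
  hilbert0 : H 0;
  hilbert_linear : forall (a : R) f g, H f -> H g -> H (a *: f + g);
  hilbert_ip : is_inner_product H ip;
  hilbert_complete : ip_complete H ip }.

(* By the Moore-Aronszajn theorem, a positive semidefinite kernel K determines
   H, and ip on H, uniquely. *)
Record is_rkhs (K : X -> X -> R) H ip : Prop := {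
  rkhs_hilbert : is_hilbert H ip;
  rkhs_kernel : forall x, H (K x);
  rkhs_reproducing : forall g x, H g -> ip g (K x) = g x }.

End FunctionSpaces.

Record is_unitary (R : realType) (X Y : Type)
    (H1 : set (X -> R)) (ip1 : (X -> R) -> (X -> R) -> R)
    (H2 : set (Y -> R)) (ip2 : (Y -> R) -> (Y -> R) -> R)
    (U : (X -> R) -> (Y -> R)) : Prop := {
  unitary_fun : set_fun H1 H2 U;
  unitary_linear : forall (a : R) f g, H1 f -> H1 g ->
    U (a *: f + g) = a *: U f + U g;
  unitary_isometry : forall f, H1 f -> ipnorm ip2 (U f) = ipnorm ip1 f;
  unitary_surj : set_surj H1 H2 U }.

Record is_inverse_on (S T : Type) (A : set S) (B : set T)
    (f : S -> T) (f' : T -> S) : Prop := {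
  inverse_fun : set_fun B A f';
  inverse_left : forall s, A s -> f' (f s) = s;
  inverse_right : forall t, B t -> f (f' t) = t }.

Section Binomial.
Variable R : realType.

Definition ell2 : set (nat -> R) :=
  [set f : nat -> R | cvgn (series (fun n => f n ^+ 2 : R))].

Definition ell2_ip (f g : nat -> R) : R := limn (series (fun n => f n * g n)).

Definition delta (n : nat) : nat -> R := fun m => (m == n)%:R.

(* 'C(x, n) = 0 when x < n. *)
Definition e (n : nat) : nat -> R := fun x => 'C(x, n)%:R.

(* \sum_n a_n e_n; pointwise, the terms with n > x vanish. *)
Definition e_series (a : nat -> R) : nat -> R :=
  fun x => limn (series (fun n => a n * e n x)).

Definition K (x y : nat) : R := limn (series (fun n => e n x * e n y)).

Definition up (f : nat -> R) : nat -> R :=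
  fun x => \sum_(j < x.+1) 'C(x, j)%:R * f j.

End Binomial.

(* Main.v *)
Require Import Defs.
From mathcomp Require Import ring.

(** The binomial transform [up] is a bijection of the space of all real
    sequences, because conjugating it by the sign change f(n) |-> (-1)^n f(n)
    gives its inverse ([up_alt_up]); this is the expansion of
    (1 - (1 + X))^n = (-X)^n. It sends the unit sequence [delta n] to the
    function [e n], and pointwise it is the same thing as f |-> \sum_n f_n e_n.

    It remains to see which sequences [up] sends into the kernel space H. By
    definition the function K(l, .) is the transform of the row
    j |-> C(l, j), so inverting the transform in the variable l writes [e n] as
    a finite combination of the functions K(l, .) ([e_kernel]). Hence [e n] lies
    in H and the reproducing property evaluates the inner product of g with
    [e n]: it is the inversion formula of g at n ([ip_e]). Everything follows.
    The family [e n] is orthonormal since [e n] is the transform of [delta n];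
    it is total since the inversion formula is injective; so H is isometric to
    the space of square-summable coefficient sequences, by Bessel's inequality
    in one direction ([coef_ell2]) and by the Riesz-Fischer theorem
    ([riesz_fischer]) in the other. *)

Set Implicit Arguments.
Unset Strict Implicit.
Unset Printing Implicit Defensive.

Local Open Scope classical_set_scope.
Local Open Scope ring_scope.

(** * The binomial transform and its inverse *)

Section BinomialTransform.
Variable R : realType.
Implicit Types (u f g a : nat -> R).

Lemma lim_series_finite u m :
  (forall n, (m <= n)%N -> u n = 0) -> limn (series u) = \sum_(i < m) u i.
Proof.
move=> u0; apply: norm_lim_near_cst; exists m => // n /= mn.
rewrite /series /= (big_cat_nat (leq0n m) mn) /= big_mkord.
rewrite [X in _ + X]big_nat_cond [X in _ + X]big1 ?addr0 // => i.
by case/andP => /andP[mi _] _; exact: u0.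
Qed.

(** A summation range independent of x, so that the two sums of a double
    transform can be exchanged. *)
Lemma up_widen f x N :
  (x <= N)%N -> up f x = \sum_(j < N.+1) 'C(x, j)%:R * f j.
Proof.
move=> xN; rewrite /up (big_ord_widen N.+1 (fun j => 'C(x, j)%:R * f j)) //.
rewrite big_mkcond; apply: eq_bigr => j _.
by case: ltnP => // xj; rewrite bin_small // mul0r.
Qed.

Lemma e_series_up a : e_series a = up a.
Proof.
apply/funext => x; rewrite /e_series (@lim_series_finite _ x.+1).
  by apply: eq_bigr => j _; rewrite /e mulrC.
by move=> n xn; rewrite /e bin_small // mulr0.
Qed.

Lemma K_up x y : K R x y = up (fun j => 'C(x, j)%:R) y.
Proof.
have -> : K R x y = e_series (fun j => 'C(x, j)%:R) y by [].
by rewrite e_series_up.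
Qed.

Lemma K_sym x y : K R x y = K R y x.
Proof.
by congr (limn (series _)); apply/funext => n; rewrite mulrC.
Qed.

Lemma up_delta m : up (delta R m) = e R m.
Proof.
apply/funext => x; rewrite (@up_widen _ x (x + m)) ?leq_addr //.
have mx : (m < (x + m).+1)%N by rewrite ltnS leq_addl.
rewrite (bigD1 (Ordinal mx)) //= /delta eqxx mulr1 big1 ?addr0 // => i.
by rewrite -val_eqE /= => /negbTE ->; rewrite mulr0.
Qed.

Lemma up_linear (c : R) f g : up (c *: f + g) = c *: up f + up g.
Proof.
apply/funext => x; rewrite /up !fctE scaler_sumr -big_split /=.
by apply: eq_bigr => j _; rewrite mulrDr scalerAr.
Qed.

Definition alt f : nat -> R := fun n => (-1) ^+ n * f n.

Lemma alt_alt f : alt (alt f) = f.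
Proof. by apply/funext => n; rewrite /alt mulrA -expr2 sqrr_sign mul1r. Qed.

(** Compare the coefficients of X^j in (1 - (1 + X))^n = (-X)^n. *)
Lemma sum_binomial_alt n j :
  \sum_(l < n.+1) 'C(n, l)%:R * ((-1) ^+ l * 'C(l, j)%:R)
    = (-1) ^+ n * (n == j)%:R :> R.
Proof.
have coefX1 l : (('X + 1) ^+ l : {poly R})`_j = 'C(l, j)%:R.
  transitivity (up (delta R j) l); last by rewrite up_delta.
  rewrite exprD1n coef_sum; apply: eq_bigr => i _.
  by rewrite coefMn coefXn -[LHS]mulr_natl /delta eq_sym.
have signP k : (-1) ^+ k = ((-1) ^+ k)%:P :> {poly R}.
  by rewrite rmorphXn rmorphN rmorph1.
have : ((1 - ('X + 1)) ^+ n : {poly R})`_j = (-1) ^+ n * (n == j)%:R.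
  rewrite opprD addrC addrNK (exprNn 'X).
  by rewrite signP coefCM coefXn eq_sym.
move=> <-; rewrite exprBn coef_sum; apply: eq_bigr => l _.
by rewrite signP expr1n mulr1 coefMn coefCM coefX1 mulr_natl.
Qed.

(** In operator form: with U the transform and A the sign change, U A U = A.
    As A is an involution, A U A is then a two-sided inverse of U, and one
    orthogonality relation gives both cancellation laws. *)
Lemma up_alt_up f : up (alt (up f)) = alt f.
Proof.
apply/funext => n; rewrite {1}/up.
under eq_bigr => l _ do
  rewrite /alt (@up_widen f l n) ?leq_ord // mulrA big_distrr /=.
rewrite exchange_big /=.
under eq_bigr => j _.
  rewrite (eq_bigr (fun l : 'I_n.+1 =>
    'C(n, l)%:R * ((-1) ^+ l * 'C(l, j)%:R) * f j)); last first.
    by move=> l _; rewrite !mulrA.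
  rewrite -mulr_suml sum_binomial_alt -mulrA.
  over.
rewrite -mulr_sumr (bigD1 ord_max) //= eqxx mul1r big1 ?addr0 // => j.
by rewrite -val_eqE /= eq_sym => /negbTE ->; rewrite mul0r.
Qed.

Definition binomial_inversion g : nat -> R := fun n =>
  \sum_(l < n.+1) 'C(n, l)%:R * (-1) ^ (l%:Z - n%:Z) * g l.

Lemma binomial_inversionE g : binomial_inversion g = alt (up (alt g)).
Proof.
apply/funext => n; rewrite /binomial_inversion /alt /up big_distrr /=.
apply: eq_bigr => l _.
have -> : (-1) ^ (l%:Z - n%:Z) = (-1) ^+ n * (-1) ^+ l :> R.
  rewrite expfzDr ?oppr_eq0 ?oner_eq0 // mulrC.
  by rewrite -exprz_inv invrN1.
by rewrite !mulrA; congr (_ * _ * _); rewrite mulrC.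
Qed.

Lemma upK : cancel (@up R) binomial_inversion.
Proof. by move=> f; rewrite binomial_inversionE up_alt_up alt_alt. Qed.

Lemma binomial_inversionK : cancel binomial_inversion (@up R).
Proof. by move=> g; rewrite binomial_inversionE up_alt_up alt_alt. Qed.

End BinomialTransform.

(** * Orthonormal sequences in a Hilbert space of functions *)

Section HilbertSpace.
Variables (R : realType) (X : Type).
Variables (H : set (X -> R)) (ip : (X -> R) -> (X -> R) -> R).
Hypothesis hH : is_hilbert H ip.
Implicit Types (f g h : X -> R) (c : nat -> R).

Let ipP := hilbert_ip hH.

Lemma hilbertZ (a : R) f : H f -> H (a *: f).
Proof.
move=> Hf; rewrite -[a *: f]addr0.
exact: (hilbert_linear hH a Hf (hilbert0 hH)).
Qed.

Lemma hilbertD f g : H f -> H g -> H (f + g).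
Proof. by move=> Hf Hg; rewrite -[f]scale1r; exact: (hilbert_linear hH). Qed.

Lemma hilbertB f g : H f -> H g -> H (f - g).
Proof.
by move=> Hf Hg; apply: hilbertD => //; rewrite -scaleN1r; exact: hilbertZ.
Qed.

Lemma hilbert_sum n (F : 'I_n -> (X -> R)) :
  (forall i, H (F i)) -> H (\sum_(i < n) F i).
Proof.
move=> HF; elim/big_ind : _ => //; first exact: hilbert0 hH.
exact: hilbertD.
Qed.

Lemma ipDl f g h : H f -> H g -> H h -> ip (f + g) h = ip f h + ip g h.
Proof.
by move=> Hf Hg Hh; have := ip_linear ipP 1 Hf Hg Hh; rewrite scale1r mul1r.
Qed.

Lemma ip0l h : H h -> ip 0 h = 0.
Proof.
move=> Hh; have H0 := hilbert0 hH.
by have /eqP := ipDl H0 H0 Hh; rewrite addr0 -subr_eq0 opprD addNKr oppr_eq0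
  => /eqP.
Qed.

Lemma ipZl (a : R) f h : H f -> H h -> ip (a *: f) h = a * ip f h.
Proof.
move=> Hf Hh; have := ip_linear ipP a Hf (hilbert0 hH) Hh.
by rewrite addr0 ip0l // addr0.
Qed.

Lemma ipBl f g h : H f -> H g -> H h -> ip (f - g) h = ip f h - ip g h.
Proof.
move=> Hf Hg Hh; rewrite -[- g]scaleN1r ipDl //; last exact: hilbertZ.
by rewrite ipZl // mulN1r.
Qed.

Lemma ipBr f g h : H f -> H g -> H h -> ip h (f - g) = ip h f - ip h g.
Proof.
move=> Hf Hg Hh; have Hfg := hilbertB Hf Hg.
by rewrite !(ip_sym ipP Hh) // ipBl.
Qed.

Lemma ip_distC f g : H f -> H g -> ip (f - g) (f - g) = ip (g - f) (g - f).
Proof.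
move=> Hf Hg; have Hfg := hilbertB Hf Hg; have Hgf := hilbertB Hg Hf.
by rewrite !ipBl // !ipBr //; ring.
Qed.

Lemma ip_lincombl n (a : 'I_n -> R) (F : 'I_n -> (X -> R)) h :
  (forall i, H (F i)) -> H h ->
  ip (\sum_(i < n) a i *: F i) h = \sum_(i < n) a i * ip (F i) h.
Proof.
move=> HF Hh.
elim: n a F HF => [|n IH] a F HF; first by rewrite !big_ord0 ip0l.
have HaF i : H (a i *: F i) by exact: hilbertZ.
rewrite !big_ord_recr /= ipDl ?ipZl ?IH //.
exact: hilbert_sum.
Qed.

Variable v : nat -> (X -> R).
Hypothesis Hv : forall n, H (v n).
Hypothesis v_orthonormal : forall m n, ip (v m) (v n) = (m == n)%:R.

Definition lincomb c N := \sum_(i < N) c i *: v i.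

Lemma hilbert_lincomb c N : H (lincomb c N).
Proof. by apply: hilbert_sum => i; exact: hilbertZ. Qed.

Lemma ip_lincomb_basis c N j :
  ip (lincomb c N) (v j) = if (j < N)%N then c j else 0.
Proof.
rewrite ip_lincombl //.
under eq_bigr => i _ do rewrite v_orthonormal.
case: ltnP => jN.
  rewrite (bigD1 (Ordinal jN)) //= eqxx mulr1 big1 ?addr0 // => i.
  by rewrite -val_eqE /= => /negbTE ->; rewrite mulr0.
rewrite big1 // => i _; rewrite (_ : (i == j :> nat) = false) ?mulr0 //.
by apply/negbTE; rewrite neq_ltn (leq_trans (ltn_ord i) jN).
Qed.

(** Pythagoras: the combination with the coefficients of g is the orthogonal
    projection of g. The coefficients are a separate sequence [c] so that the
    identity also applies to the combinations of a fixed [c]. *)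
Lemma bessel_identity g c N : H g -> (forall i, (i < N)%N -> ip g (v i) = c i) ->
  ip (lincomb c N - g) (lincomb c N - g)
    = ip g g - \sum_(i < N) c i ^+ 2.
Proof.
move=> Hg gc; have Hs := hilbert_lincomb c N.
have gs : ip (lincomb c N) g = \sum_(i < N) c i ^+ 2.
  rewrite ip_lincombl //; apply: eq_bigr => i _.
  by rewrite (ip_sym ipP (Hv i) Hg) gc // expr2.
have ss : ip (lincomb c N) (lincomb c N) = \sum_(i < N) c i ^+ 2.
  rewrite {1}/lincomb ip_lincombl //; apply: eq_bigr => i _.
  by rewrite (ip_sym ipP (Hv i) Hs) ip_lincomb_basis ltn_ord expr2.
have Hsg := hilbertB Hs Hg.
by rewrite ipBl // !ipBr // (ip_sym ipP Hg Hs) gs ss; ring.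
Qed.

Lemma bessel_inequality g N : H g -> \sum_(i < N) ip g (v i) ^+ 2 <= ip g g.
Proof.
move=> Hg; rewrite -subr_ge0.
rewrite -(@bessel_identity g (fun i => ip g (v i)) N) //.
by apply: (ip_ge0 ipP); apply: hilbertB => //; exact: hilbert_lincomb.
Qed.

(** Continuity of the coefficient functionals, which stands in for the
    Cauchy-Schwarz inequality when passing to the limit. *)
Lemma coef_sqr_le g j : H g -> ip g (v j) ^+ 2 <= ip g g.
Proof.
move=> Hg; apply: le_trans (bessel_inequality j.+1 Hg).
by rewrite big_ord_recr /= lerDr sumr_ge0 // => i _; exact: sqr_ge0.
Qed.

Lemma ip_lincombB c m n :
  ip (lincomb c m - lincomb c n) (lincomb c m - lincomb c n)
    = `|\sum_(i < m) c i ^+ 2 - \sum_(i < n) c i ^+ 2|.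
Proof.
(* For m <= n, apply the Bessel identity to the longer combination, whose first
   m coefficients are those of the shorter one. *)
wlog mn : m n / (m <= n)%N => [sym|].
  case/orP: (leq_total m n) => [|nm]; first exact: sym.
  rewrite ip_distC; [|exact: hilbert_lincomb..].
  by rewrite distrC; exact: sym.
have Hn := hilbert_lincomb c n.
have coef i : (i < n)%N -> ip (lincomb c n) (v i) = c i.
  by move=> i_n; rewrite ip_lincomb_basis i_n.
have nn : ip (lincomb c n) (lincomb c n) = \sum_(i < n) c i ^+ 2.
  have := bessel_identity Hn coef.
  rewrite subrr ip0l; last exact: hilbert0 hH.
  by move/eqP; rewrite eq_sym subr_eq0 => /eqP.
have E : ip (lincomb c m - lincomb c n) (lincomb c m - lincomb c n)
    = \sum_(i < n) c i ^+ 2 - \sum_(i < m) c i ^+ 2.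
  rewrite (@bessel_identity (lincomb c n) c m) ?nn // => i im.
  by apply: coef; exact: leq_trans im mn.
rewrite E distrC ger0_norm // -E.
by apply: (ip_ge0 ipP); apply: hilbertB => //; exact: hilbert_lincomb.
Qed.

(** The combinations are Cauchy since their distances are those of the partial
    sums of the c_n^2; completeness provides g, coefficients pass to the limit,
    and the Bessel identity turns convergence to g into Parseval's formula. *)
Lemma riesz_fischer c : ell2 c ->
  exists2 g, H g & (forall j, ip g (v j) = c j) /\
    series (fun n => c n ^+ 2) @ \oo --> ip g g.
Proof.
move=> cvgc.
pose S n := \sum_(i < n) c i ^+ 2.
have SE : series (fun n => c n ^+ 2) = S.
  by apply/funext => n; rewrite /series /= big_mkord.
have Hp := hilbert_lincomb c.
have [|g Hg cvg_g] := hilbert_complete hH Hp.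
  move=> eps eps0.
  (* Squared distances are compared with eps^2, and the two indices are linked
     through the limit. *)
  have e20 : 0 < eps ^+ 2 / 2 by rewrite divr_gt0 // exprn_gt0.
  have /cvgrPdist_lt/(_ _ e20)[N _ HN] := cvgc.
  exists N => m n Nm Nn.
  rewrite /ipnorm ip_lincombB -[ltRHS](ger0_norm (ltW eps0)) -(sqrtr_sqr eps).
  rewrite ltr_sqrt ?exprn_gt0 // -/(S m) -/(S n).
  have := HN m Nm; have := HN n Nn; rewrite /= SE => Hn Hm.
  rewrite [ltRHS]splitr; set L := limn _ in Hn Hm.
  rewrite -(subrKA L) (le_lt_trans (ler_normD _ _)) // ltrD //.
  by rewrite distrC.
have cvg_sq : (fun n => ip (lincomb c n - g) (lincomb c n - g)) @ \oo --> (0 : R).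
  have -> : (fun n => ip (lincomb c n - g) (lincomb c n - g)) =
      (fun n => ipnorm ip (lincomb c n - g) * ipnorm ip (lincomb c n - g)).
    apply/funext => n; rewrite /ipnorm -expr2 sqr_sqrtr //.
    by apply: (ip_ge0 ipP); exact: hilbertB.
  by rewrite -(mul0r (0 : R)); exact: cvgM.
have coef j : ip g (v j) = c j.
  apply/eqP; rewrite eq_sym -subr_eq0 -sqrf_eq0 eq_le sqr_ge0 andbT.
  rewrite -(cvg_lim _ cvg_sq) //; apply: limr_ge.
    by apply/cvg_ex; exists 0.
  exists j.+1 => // n /= jn.
  have := @coef_sqr_le (lincomb c n - g) j (hilbertB (Hp n) Hg).
  by rewrite ipBl // ip_lincomb_basis jn.
exists g => //; split=> //.
rewrite SE.
have -> : S = (fun n => ip g g - ip (lincomb c n - g) (lincomb c n - g)).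
  by apply/funext => n; rewrite (@bessel_identity g c n) // subKr.
by rewrite -[X in _ --> X]subr0; apply: cvgB => //; exact: cvg_cst.
Qed.

Lemma coef_ell2 g : H g -> ell2 (fun n => ip g (v n)).
Proof.
move=> Hg; apply: nondecreasing_is_cvgn.
  apply: nondecreasing_series => n _ _; exact: sqr_ge0.
exists (ip g g) => _ [n _ <-]; rewrite /series /= big_mkord.
exact: bessel_inequality.
Qed.

End HilbertSpace.

(** * The orthonormal basis of the kernel space *)

Section KernelSpace.
Variables (R : realType) (H : set (nat -> R)).
Variable ip : (nat -> R) -> (nat -> R) -> R.
Hypothesis hH : is_rkhs (@K R) H ip.

Let hilb := rkhs_hilbert hH.

(** K(l, y) = K(y, l) is, as a function of l, the transform of j |-> C(y, j), and
    the inversion formula recovers C(y, n) = e_n(y). *)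
Lemma e_kernel n :
  e R n = \sum_(l < n.+1) ('C(n, l)%:R * (-1) ^ (l%:Z - n%:Z)) *: K R l.
Proof.
apply/funext => y.
rewrite fct_sumE.
transitivity (binomial_inversion (K R y) n).
  have -> : K R y = up (fun j => 'C(y, j)%:R) by apply/funext => l; exact: K_up.
  by rewrite upK.
by apply: eq_bigr => l _; rewrite K_sym.
Qed.

Lemma rkhs_e n : H (e R n).
Proof.
rewrite e_kernel; apply: (hilbert_sum hilb) => l.
by apply: (hilbertZ hilb); exact: rkhs_kernel hH l.
Qed.

Lemma ip_e g n : H g -> ip g (e R n) = binomial_inversion g n.
Proof.
move=> Hg; rewrite (ip_sym (hilbert_ip hilb) Hg (rkhs_e n)) e_kernel.
have HK := rkhs_kernel hH.
rewrite (ip_lincombl hilb) //; apply: eq_bigr => l _.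
by rewrite (ip_sym (hilbert_ip hilb) (HK l) Hg) (rkhs_reproducing hH).
Qed.

Lemma e_orthonormal m n : ip (e R m) (e R n) = (m == n)%:R.
Proof.
by rewrite ip_e; [rewrite -up_delta upK /delta eq_sym | exact: rkhs_e].
Qed.

Lemma binomial_inversion_ell2 g : H g -> ell2 (binomial_inversion g).
Proof.
move=> Hg; have := coef_ell2 hilb rkhs_e e_orthonormal Hg.
by have -> : (fun n => ip g (e R n)) = binomial_inversion g
  by apply/funext => n; rewrite ip_e.
Qed.

(** The inversion formula sends the element of H with coefficients [f] back to
    [f], so this element is [up f]; its norm is given by Parseval's formula. *)
Lemma up_rkhs f : ell2 f -> H (up f) /\ ip (up f) (up f) = ell2_ip f f.
Proof.
move=> /(riesz_fischer hilb rkhs_e e_orthonormal)[g Hg [coef parseval]].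
have -> : up f = g.
  rewrite -[RHS]binomial_inversionK; congr up.
  by apply/funext => n; rewrite -coef ip_e.
by split => //; apply/esym; apply: cvg_lim.
Qed.

End KernelSpace.

(** * Expansion in unit sequences and the theorem *)

(** The squared distance of [a] to its truncation is the tail of the convergent
    series of the a_n^2. *)
Lemma ell2_tail (R : realType) (a : nat -> R) : ell2 a ->
  (fun N : nat => ipnorm (@ell2_ip R) (a - \sum_(n < N) a n *: delta R n))
    @ \oo --> (0 : R).
Proof.
move=> cvga; set A := series (fun n => a n ^+ 2).
have tail N n : (a - \sum_(i < N) a i *: delta R i) n
    = if (n < N)%N then 0 else a n.
  rewrite !fctE fct_sumE.
  under eq_bigr => i _ do rewrite fctE /delta.
  case: ltnP => nN.
    rewrite (bigD1 (Ordinal nN)) //= eqxx /GRing.scale /= mulr1 big1.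
      by rewrite addr0 subrr.
    by move=> i; rewrite -val_eqE /= eq_sym => /negbTE ->; rewrite mulr0.
  rewrite big1 ?subr0 // => i _; rewrite (_ : (n == i :> nat) = false).
    by rewrite /GRing.scale /= mulr0.
  by apply/negbTE; rewrite neq_ltn (leq_trans (ltn_ord i) nN) orbT.
have tail_ip N : ell2_ip (a - \sum_(i < N) a i *: delta R i)
    (a - \sum_(i < N) a i *: delta R i) = limn A - A N.
  apply: cvg_lim => //.
  apply: (@cvg_trans _ ((fun n => A n - A N) @ \oo)); last first.
    by apply: cvgB => //; exact: cvg_cst.
  apply: near_eq_cvg; exists N => // n /= Nn.
  rewrite /A /series /= (big_cat_nat (leq0n N) Nn) /= addrAC subrr add0r.
  rewrite [RHS](big_cat_nat (leq0n N) Nn) /=.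
  rewrite [X in _ = X + _]big_nat_cond [X in _ = X + _]big1 ?add0r.
    by rewrite !big_nat; apply: eq_bigr => i /andP[Ni _];
      rewrite tail ltnNge Ni expr2.
  by move=> i /andP[/andP[_ iN] _]; rewrite tail iN mul0r.
have -> : (fun N : nat => ipnorm (@ell2_ip R)
    (a - \sum_(n < N) a n *: delta R n)) = (fun N => Num.sqrt (limn A - A N)).
  by apply/funext => N; rewrite /ipnorm tail_ip.
have cvg0 : (fun N => limn A - A N) @ \oo --> (0 : R).
  by rewrite -[X in _ --> X](subrr (limn A)); apply: cvgB => //; exact: cvg_cst.
rewrite -[X in _ --> X]sqrtr0.
by apply: (cvg_comp _ _ cvg0); exact: sqrt_continuous.
Qed.

Unset Implicit Arguments.

Theorem theorem3p6 (R : realType) (H : set (nat -> R))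
    (ip : (nat -> R) -> (nat -> R) -> R) (hH : is_rkhs (@K R) H ip) :
  is_unitary (@ell2 R) (@ell2_ip R) H ip (@up R) /\
  exists down : (nat -> R) -> (nat -> R),
    [/\ is_inverse_on (@ell2 R) H (@up R) down,
        (forall g, H g -> exists2 a, ell2 a & g = e_series a),
        (forall g a, H g -> g = e_series a ->
           (fun N : nat => ipnorm (@ell2_ip R)
              (down g - \sum_(n < N) a n *: delta R n)) @ \oo --> (0 : R))
      & (forall g n, H g ->
           down g n =
           \sum_(l < n.+1) 'C(n, l)%:R * (-1) ^ (l%:Z - n%:Z) * g l)].
Proof.
split.
  split.
  - by move=> f /(up_rkhs hH)[].
  - by move=> a f g _ _; exact: up_linear.
  - by move=> f /(up_rkhs hH)[_ E]; rewrite /ipnorm E.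
  - move=> g Hg; exists (binomial_inversion g).
      exact: (binomial_inversion_ell2 hH).
    exact: binomial_inversionK.
exists (@binomial_inversion R); split.
- by split; [exact: (binomial_inversion_ell2 hH) | move=> f _; exact: upK
            | move=> g _; exact: binomial_inversionK].
- move=> g Hg; exists (binomial_inversion g).
    exact: (binomial_inversion_ell2 hH).
  by rewrite e_series_up binomial_inversionK.
- move=> g a Hg ga.
  have da : binomial_inversion g = a by rewrite ga e_series_up upK.
  rewrite da; apply: ell2_tail; rewrite -da.
  exact: (binomial_inversion_ell2 hH).
- by [].
Qed.
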